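(* Let $n\ge 5$ be an integer. Then the generalized Petersen graph $GP(n,2)$ is not $\Gamma$-distance magic for any Abelian group $\Gamma$ of order $2n$.
   Context: For positive integers $n,k$ with $1\le k<n/2$, the generalized Petersen graph $GP(n,k)$ is the graph on the $2n$ vertices $\{x_i,y_i: i\in\mathbb{Z}_n\}$ with edges $x_ix_{i+1}$, $y_iy_{i+k}$ and $x_iy_i$ for $i\in\mathbb{Z}_n$ (indices modulo $n$). For a graph $G=(V,E)$ and an Abelian group $\Gamma$ (written additively) of order $|V|$, a $\Gamma$-distance magic labeling of $G$ is a bijection $\ell: V\to\Gamma$ for which there is $\mu\in\Gamma$ such that $\sum_{y\in N(x)}\ell(y)=\mu$ for every $x\in V$, where $N(x)$ is the set of neighbors of $x$. $G$ is $\Gamma$-distance magic if such a labeling exists. *)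

(* Defs.v *)
From HB Require Import structures.
From mathcomp Require Import all_boot all_order all_algebra.

Set Implicit Arguments.
Unset Strict Implicit.
Unset Printing Implicit Defensive.

Import GRing.Theory.
Local Open Scope ring_scope.

(* A finite simple graph is a symmetric irreflexive relation on a finType. *)

Definition neighbors (V : finType) (e : rel V) (x : V) : {set V} :=
  [set y | e x y].

(* The requirement that Gamma have order #|V| follows from bijectivity. *)
Definition distance_magic_labeling (V : finType) (e : rel V)
    (Gamma : finZmodType) (l : V -> Gamma) : Prop :=
  bijective l /\
  exists mu : Gamma, forall x : V, \sum_(y in neighbors e x) l y = mu.

Definition distance_magic (V : finType) (e : rel V) (Gamma : finZmodType)
    : Prop :=
  exists l : V -> Gamma, distance_magic_labeling e l.

(* inl i is x_i and inr i is y_i. Since 'Z_n is the ring of integers mod n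
   only for n > 1, this and GP are meant for 1 <= k < n / 2, which forces
   n >= 3. *)
Definition GP_vertex (n : nat) : finType := ('Z_n + 'Z_n)%type.

(* Each edge, oriented as x_i x_(i+1), y_i y_(i+k) or x_i y_i. *)
Definition GP_arc (n k : nat) (u v : GP_vertex n) : bool :=
  match u, v with
  | inl i, inl j => j == i + 1
  | inr i, inr j => j == i + k%:R
  | inl i, inr j => j == i
  | inr _, inl _ => false
  end.

Definition GP (n k : nat) : rel (GP_vertex n) :=
  fun u v => GP_arc k u v || GP_arc k v u.
Arguments GP : clear implicits.

Lemma card_GP_vertex (n : nat) : (1 < n)%N -> #|GP_vertex n| = (2 * n)%N.
Proof. by move=> n1; rewrite card_sum !card_ord Zp_cast // mul2n addnn. Qed.

Lemma GP_sym (n k : nat) : symmetric (GP n k).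
Proof. by move=> u v; rewrite /GP orbC. Qed.

Lemma GP_irr (n k : nat) : (1 <= k)%N -> (2 * k < n)%N ->
  irreflexive (GP n k).
Proof.
move=> k1 kn.
have n1 : (1 < n)%N by apply: leq_trans kn; rewrite ltnS muln_gt0.
have kltn : (k < n)%N by apply: leq_ltn_trans kn; rewrite leq_pmull.
have neq (i : 'Z_n) m : (0 < m < n)%N -> (i == i + m%:R) = false.
  case/andP=> m0 mn; apply/negbTE; rewrite -subr_eq0 opprD addNKr oppr_eq0.
  apply/eqP=> /(congr1 (@nat_of_ord _)); rewrite val_Zp_nat // modn_small //.
  by move=> m00; rewrite m00 in m0.
case=> i; rewrite /GP /= orbb; first by rewrite (neq i 1%N).
by rewrite neq // k1.
Qed.

(* Main.v *)
Require Import Defs.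
From mathcomp Require Import all_boot all_order all_algebra.
From mathcomp Require Import all_fingroup all_solvable.
From mathcomp Require Import ring zify.

Set Implicit Arguments.
Unset Strict Implicit.
Unset Printing Implicit Defensive.

Import GRing.Theory.
Local Open Scope ring_scope.

(** Write a_i and b_i for the labels of x_i and y_i. Magic at x_i gives
    b_i = mu - a_(i-1) - a_(i+1); substituting this in the condition at y_i
    leaves a linear recurrence for a alone, with characteristic polynomial

      X^6 + X^4 - X^3 + X^2 + 1
        = (X^2 + X + 1) (X^4 - X^3 + X^2 - X + 1) = Phi_3 Phi_10.

    Since Phi_3 and Phi_10 have resultant 1, a splits over the integers as
    f + g, where f has period 3 and g changes sign under a shift by 5, hence
    under a shift by 15. The sequence b splits in the same way, with the same
    f. So a_i + a_(i+15) = 2 f_i = b_i + b_(i+15) (magic_half_turn), and this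
    with the period of f is all that the rest uses.

    It follows that a_(i+30) = a_i, so n divides 30, and the order 2n of the
    group is not a multiple of 8. Let K be the subgroup of the x with 2x = 0;
    if it has more than two elements, its order is a multiple of 4.

    - n odd. Then n divides 15, so 2 a_i = 2 f_i has period 3. Thus a_0, a_3,
      a_6 are three labels with the same double, K has more than two elements,
      and 4 divides 2n: a contradiction.

    - n even. Then i |-> i + 15 is an involution of Z_n without fixed points,
      and the two labels that it pairs add up to the double 2 f_i.
      If K has more than two elements, then 4 divides |K|, so the number
      |2 Gamma| = 2n / |K| of doubles is odd. But a label is a double exactly
      when its partner is one, so this number is even.
      Otherwise K = {0, t}, and t is the sum of all the elements of Gamma.
      Adding the labels pair by pair gives t = 4s, where s is the sum of the
      f_i over a set of representatives of the pairs. Then s has order 8,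
      which does not divide 2n. *)

(** * Involutions without fixed points *)

(** Comparing ranks chooses one element in each pair {x, s x}. *)
Lemma big_involution (R : Type) (idx : R) (op : Monoid.com_law idx)
    (T : finType) (s : T -> T) (A : {pred T}) (F : T -> R) :
    involutive s -> {in A, forall x, (s x \in A) && (s x != x)} ->
  \big[op/idx]_(x in A) F x =
  \big[op/idx]_(x in A | (enum_rank x < enum_rank (s x))%N) op (F x) (F (s x)).
Proof.
move=> sK sA; have inj_s := inv_inj sK.
rewrite big_split /= (bigID (fun x => (enum_rank x < enum_rank (s x))%N)) /=.
congr (op _ _); rewrite (reindex_inj inj_s); apply: eq_bigl => x.
rewrite sK -leqNgt leq_eqVlt.
have -> : (s x \in A) = (x \in A).
  by apply/idP/idP => /sA /andP[]; rewrite ?sK.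
case: (boolP (x \in A)) => //= /sA/andP[_ sx_neq].
by rewrite (inj_eq val_inj) (inj_eq enum_rank_inj) eq_sym (negPf sx_neq).
Qed.

Lemma even_card_involution (T : finType) (s : T -> T) (A : {set T}) :
    involutive s -> {in A, forall x, (s x \in A) && (s x != x)} ->
  ~~ odd #|A|.
Proof.
move=> sK sA; rewrite -sum1_card (big_involution _ _ sK sA) /=.
by rewrite sum_nat_const muln2 odd_double.
Qed.

(** * Doubling in a finite abelian group *)

Definition two_torsion (G : finZmodType) : {set G} := [set x | x *+ 2 == 0].

Definition doubles (G : finZmodType) : {set G} := [set x *+ 2 | x : G].

Lemma double_morphic (G : finZmodType) :
  {in [set: G] &, {morph (fun x : G => x *+ 2) : x y / (x * y)%g}}.
Proof. by move=> x y _ _; rewrite !FinRing.zmodMgE mulrnDl. Qed.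

Canonical double_morphism (G : finZmodType) := Morphism (@double_morphic G).

Lemma two_torsionE (G : finZmodType) :
  two_torsion G = ('ker (double_morphism G))%g.
Proof. by apply/setP=> x; rewrite !inE /= FinRing.zmod1gE. Qed.

Lemma card_two_torsion_doubles (G : finZmodType) :
  (#|two_torsion G| * #|doubles G| = #|G|)%N.
Proof.
have -> : doubles G = (double_morphism G @* [set: G])%g.
  apply/setP=> y; apply/imsetP/morphimP => /= [[x _ ->] | [x _ _ ->]];
  by exists x; rewrite ?inE.
rewrite card_morphim setTI two_torsionE -cardsT.
exact: Lagrange (subsetT _).
Qed.

(** By Cauchy's theorem, a group of exponent 2 has a power of 2 as order. *)
Lemma four_dvd_card_two_torsion (G : finZmodType) :
  (2 < #|two_torsion G|)%N -> (4 %| #|two_torsion G|)%N.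
Proof.
rewrite two_torsionE => K_gt2.
have : (2.-group ('ker (double_morphism G)))%g.
  apply/pgroupP=> p p_pr /(Cauchy p_pr)[x Kx ox].
  have x2 : (x ^+ 2)%g = 1%g.
    by have := mker Kx; rewrite /= -FinRing.zmodXgE.
  by rewrite inE /= -(dvdn_prime2 p_pr) // -ox order_dvdn x2.
case/p_natP=> [[|[|k]]] eqK; rewrite eqK // in K_gt2 *.
by rewrite (dvdn_exp2l 2 (isT : (2 <= k.+2)%N)).
Qed.

Lemma two_torsion_gt2 (G : finZmodType) (x y z : G) :
    x != y -> y != z -> z != x -> x *+ 2 = y *+ 2 -> y *+ 2 = z *+ 2 ->
  (2 < #|two_torsion G|)%N.
Proof.
move=> xy yz zx x2 y2.
have u : uniq [:: x - x; y - x; z - x].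
  by rewrite /= !inE !(inj_eq (addIr _)) negb_or xy yz eq_sym zx.
rewrite -[3%N]/(size [:: x - x; y - x; z - x]) -(card_uniqP u).
apply/subset_leq_card/subsetP=> w.
by rewrite !inE => /or3P[]/eqP->; rewrite mulrnBl -?y2 -?x2 subrr.
Qed.

(** The elements that are not their own opposite cancel in pairs x, -x. *)
Lemma sum_unique_involution (G : finZmodType) (t : G) :
  t != 0 -> two_torsion G = [set 0; t] -> \sum_(x : G) x = t.
Proof.
move=> t_neq0 eqK.
rewrite (bigID [in two_torsion G]) /= [X in _ + X](_ : _ = 0).
  by rewrite addr0 eqK big_setU1 ?inE 1?eq_sym //= big_set1 add0r.
rewrite (eq_bigl [in ~: two_torsion G]); last by move=> x; rewrite !inE.
rewrite (big_involution _ _ (@opprK G)) /=; last first.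
  move=> x; rewrite !inE mulNrn oppr_eq0 => x2; rewrite x2 /=.
  by apply: contra x2 => /eqP xx; rewrite mulr2n -[X in X + _]xx addNr.
by apply: big1 => x _; rewrite subrr.
Qed.

Lemma eight_dvd_card (G : finZmodType) (s : G) :
  s *+ 8 = 0 -> s *+ 4 != 0 -> (8 %| #|G|)%N.
Proof.
move=> s8 s4.
have ord4 : ~~ (#[s]%g %| 4)%N by rewrite order_dvdn FinRing.zmodXgE.
have : (#[s]%g %| 2 ^ 3)%N by rewrite order_dvdn FinRing.zmodXgE s8.
case/(dvdn_pfactor _ _ (isT : prime 2)) => k.
rewrite leq_eqVlt => /orP[/eqP-> os|].
  by rewrite -[8%N]os -cardsT order_dvdG ?inE.
rewrite ltnS => k2 os; case/negP: ord4; rewrite os.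
exact: (dvdn_exp2l 2 k2).
Qed.

(** * The recurrence *)

Ltac pull_to_second y :=
  repeat match goal with
  | |- _ + (y + _) = 0 => fail 1
  | |- context [?z + (y + ?t)] => rewrite (addrCA z y t)
  end.

(** Decides equations between signed sums in an abelian group: the difference
    of the two sides is flattened, and its first term is repeatedly cancelled
    against its opposite. The trailing 0 spares a case for the last term. *)
Ltac abelian :=
  apply: subr0_eq; rewrite ?mulr2n -1?[LHS]addr0 ?opprD ?opprK -?addrA;
  repeat (rewrite ?opprD ?opprK -?addrA; match goal with
  | |- - ?x + _ = 0 => pull_to_second x; rewrite addKr
  | |- ?x + _ = 0 => pull_to_second (- x); rewrite addNKr
  end); by rewrite ?oppr0 ?addr0.

(** The polynomial X Phi_10(X) applied to a, where X is the shift. It is the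
    3-periodic component f of a, because X Phi_10(X) is 1 modulo Phi_3 and 0
    modulo Phi_10. *)
Definition alternating5 (G : zmodType) (a : nat -> G) k :=
  a k.+1 - a k.+2 + a k.+3 - a k.+4 + a k.+4.+1.

Definition magic_recurrence (G : zmodType) (mu : G) (a : nat -> G) :=
  forall k, a k.+4.+2 = mu + a k.+3 - a k - a k.+2 - a k.+4.

Lemma recurrence_outer (G : zmodType) (mu : G) (a b : nat -> G) :
    (forall k, a k + a k.+2 + b k.+1 = mu) ->
    (forall k, b k + b k.+4 + a k.+2 = mu) ->
  magic_recurrence mu a.
Proof.
move=> outer inner k.
have E j : b j.+1 = mu - a j - a j.+2 by rewrite -(outer j); abelian.
have := inner k.+1; rewrite !E => /eqP; rewrite -subr_eq0 => /eqP H.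
by apply/esym/subr0_eq; rewrite -[RHS]H; abelian.
Qed.

Lemma recurrence_inner (G : zmodType) (mu : G) (a b : nat -> G) :
    (forall k, a k + a k.+2 + b k.+1 = mu) ->
    (forall k, b k + b k.+4 + a k.+2 = mu) ->
  magic_recurrence mu b.
Proof.
move=> outer inner k.
have E j : a j.+2 = mu - b j - b j.+4 by rewrite -(inner j); abelian.
have := outer k.+2; rewrite !E => /eqP; rewrite -subr_eq0 => /eqP H.
by apply/esym/subr0_eq; rewrite -[RHS]H; abelian.
Qed.

(** The recurrence says that Phi_3 Phi_10 maps a to a constant, and X - 1
    kills constants; (X - 1) Phi_3 = X^3 - 1. *)
Lemma alternating5_periodic (G : zmodType) (mu : G) (a : nat -> G) :
  magic_recurrence mu a -> forall k, alternating5 a k.+3 = alternating5 a k.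
Proof. by move=> rec_a k; rewrite /alternating5 !rec_a; abelian. Qed.

(** The remainder g = a - f satisfies g_(k+5) = - g_k because Phi_10 divides
    X^5 + 1; as 15 is an odd multiple of 5 and a multiple of 3, g cancels in
    a_k + a_(k+15) while f is doubled. *)
Lemma half_turn (G : zmodType) (mu : G) (a : nat -> G) :
    magic_recurrence mu a ->
  forall k, a k + a (15 + k)%N = alternating5 a k *+ 2.
Proof.
move=> rec_a k.
have f3 := alternating5_periodic rec_a.
(* (X + 1) Phi_10 = X^5 + 1, with f shifted by multiples of 3. *)
have shift5 j : a j.+4.+1 = alternating5 a j + alternating5 a j.+2 - a j.
  by rewrite -(f3 j) /alternating5 !rec_a; abelian.
rewrite -[(15 + k)%N]/(k.+4.+4.+2.+4.+1).
rewrite (shift5 k.+4.+4.+2) (shift5 k.+4.+1) (shift5 k) !f3.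
abelian.
Qed.

(** b - a = mu - X^-1 Phi_3 a, and X Phi_10 maps both mu and X^-1 Phi_3 a to
    the constant mu, the latter by the recurrence. *)
Lemma alternating5_outer_inner (G : zmodType) (mu : G) (a b : nat -> G) :
    (forall k, a k + a k.+2 + b k.+1 = mu) ->
    (forall k, b k + b k.+4 + a k.+2 = mu) ->
  forall k, alternating5 a k = alternating5 b k.
Proof.
move=> outer inner k.
have E j : b j.+1 = mu - a j - a j.+2 by rewrite -(outer j); abelian.
by rewrite /alternating5 !E !(recurrence_outer outer inner); abelian.
Qed.

(** * Neighborhoods in GP(n, 2) *)

Lemma natr_Zp_eq0 (n m : nat) :
  (1 < n)%N -> ((m%:R : 'Z_n) == 0) = (n %| m)%N.
Proof. by move=> n_gt1; rewrite -(inj_eq val_inj) /= val_Zp_nat. Qed.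

Lemma addr_nat_eq (n d : nat) (i : 'Z_n) :
  (1 < n)%N -> (i + d%:R == i) = (n %| d)%N.
Proof. by move=> n_gt1; rewrite -subr_eq0 [i + _]addrC addrK natr_Zp_eq0. Qed.

Lemma sum_neighbors_outer (n : nat) (G : finZmodType) (l : GP_vertex n -> G)
    (i : 'Z_n) :
    (4 < n)%N ->
  \sum_(y in neighbors (GP n 2) (inl i)) l y =
  l (inl (i - 1)) + l (inl (i + 1)) + l (inr i).
Proof.
move=> n_gt4.
have -> : neighbors (GP n 2) (inl i) = [set inl (i - 1); inl (i + 1); inr i].
  apply/setP=> -[] j; rewrite !inE /GP /= ?orbF //.
  rewrite orbC; congr (_ || _).
  by rewrite -[i == _]subr_eq -[RHS]eq_sym.
rewrite setUC big_setU1 ?inE //= big_setU1 ?inE ?big_set1 /=.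
  by rewrite addrC.
rewrite (inj_eq (@inl_inj _ _)) -subr_eq0 (_ : _ - _ = - 2%:R); last by ring.
by rewrite oppr_eq0 natr_Zp_eq0 ?gtnNdvd; lia.
Qed.

Lemma sum_neighbors_inner (n : nat) (G : finZmodType) (l : GP_vertex n -> G)
    (i : 'Z_n) :
    (4 < n)%N ->
  \sum_(y in neighbors (GP n 2) (inr i)) l y =
  l (inr (i - 2)) + l (inr (i + 2)) + l (inl i).
Proof.
move=> n_gt4.
have -> : neighbors (GP n 2) (inr i) = [set inr (i - 2); inr (i + 2); inl i].
  apply/setP=> -[] j; rewrite !inE /GP /= ?orbF; first by rewrite eq_sym.
  rewrite orbC; congr (_ || _).
  by rewrite -[i == _]subr_eq -[RHS]eq_sym.
rewrite setUC big_setU1 ?inE //= big_setU1 ?inE ?big_set1 /=.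
  by rewrite addrC.
rewrite (inj_eq (@inr_inj _ _)) -subr_eq0 (_ : _ - _ = - 4%:R); last by ring.
by rewrite oppr_eq0 natr_Zp_eq0 ?gtnNdvd; lia.
Qed.

(** With Z_n unrolled into natural indices, shifts hold by computation. *)
Lemma magic_half_turn (n : nat) (G : finZmodType) (l : GP_vertex n -> G)
    (mu : G) :
    (4 < n)%N -> (forall v, \sum_(y in neighbors (GP n 2) v) l y = mu) ->
  exists f : nat -> G, [/\ forall k, f k.+3 = f k,
    forall k, l (inl k%:R) + l (inl (15 + k)%:R) = f k *+ 2 &
    forall k, l (inr k%:R) + l (inr (15 + k)%:R) = f k *+ 2].
Proof.
move=> n_gt4 magic.
pose a k := l (inl k%:R); pose b k := l (inr k%:R).
have outer k : a k + a k.+2 + b k.+1 = mu.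
  have := magic (inl k.+1%:R); rewrite sum_neighbors_outer //.
  by rewrite -{1}natr1 addrK natr1.
have inner k : b k + b k.+4 + a k.+2 = mu.
  have := magic (inr k.+2%:R); rewrite sum_neighbors_inner //.
  by rewrite -{1}[k.+2]addn2 natrD addrK -natrD addn2.
have rec_a := recurrence_outer outer inner.
exists (alternating5 a); split=> k; first exact: alternating5_periodic rec_a k.
  exact: half_turn rec_a k.
rewrite (alternating5_outer_inner outer inner).
by rewrite -(half_turn (recurrence_inner outer inner)).
Qed.

(** * Consequences of the half-turn relation *)

(** a_0 + a_15 = 2 f_0 = 2 f_15 = a_15 + a_30, whence a_30 = a_0. *)
Lemma dvdn_30 (n : nat) (G : finZmodType) (l : GP_vertex n -> G)
    (f : nat -> G) :
    (1 < n)%N -> injective l -> (forall k, f k.+3 = f k) ->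
    (forall k, l (inl k%:R) + l (inl (15 + k)%:R) = f k *+ 2) ->
  (n %| 30)%N.
Proof.
move=> n_gt1 l_inj f3 fa; rewrite -(addr_nat_eq 30 0 n_gt1) add0r.
apply/eqP/(@inl_inj _ 'Z_n)/l_inj/(addrI (l (inl 15%:R))).
have f15 : f 15 = f 0 by rewrite !f3.
by rewrite (fa 15) f15 -(fa 0) addrC.
Qed.

(** Here n divides 15, so the half-turn is trivial and 2 a_k = 2 f_k has
    period 3; a_0, a_3 and a_6 are distinct because n divides neither 3 nor
    6. *)
Lemma odd_two_torsion_gt2 (n : nat) (G : finZmodType) (l : GP_vertex n -> G)
    (f : nat -> G) :
    (4 < n)%N -> (n %| 30)%N -> odd n -> injective l ->
    (forall k, f k.+3 = f k) ->
    (forall k, l (inl k%:R) + l (inl (15 + k)%:R) = f k *+ 2) ->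
  (2 < #|two_torsion G|)%N.
Proof.
move=> n_gt4 n30 n_odd l_inj f3 fa.
have n_gt1 : (1 < n)%N by lia.
have n15 : (n %| 15)%N.
  by move: n30; rewrite -[30%N]/(2 * 15)%N Gauss_dvdr // coprimen2.
have double_a k : l (inl k%:R) *+ 2 = f k *+ 2.
  rewrite -fa mulr2n natrD; congr (_ + l (inl _)).
  by apply/esym/eqP; rewrite addrC addr_nat_eq.
have a_neq j d : ~~ (n %| d)%N -> l (inl (d + j)%:R) != l (inl j%:R).
  by rewrite (inj_eq l_inj) (inj_eq (@inl_inj _ _)) natrD addrC addr_nat_eq.
have ndvd3 : ~~ (n %| 3)%N by rewrite gtnNdvd; lia.
have ndvd6 : ~~ (n %| 6)%N.
  apply/negP => n6; have : (n %| gcdn 15 6)%N by rewrite dvdn_gcd n15.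
  exact/negP.
apply: (@two_torsion_gt2 _ (l (inl 0%:R)) (l (inl 3%:R)) (l (inl 6%:R))).
- by rewrite eq_sym; apply: (a_neq 0 3)%N.
- by rewrite eq_sym; apply: (a_neq 3 3)%N.
- exact: (a_neq 0 6)%N.
- by rewrite !double_a !f3.
- by rewrite !double_a !f3.
Qed.

Lemma half_turnK (n : nat) :
  (1 < n)%N -> (n %| 30)%N -> involutive (fun i : 'Z_n => i + 15%:R).
Proof.
by move=> n_gt1 n30 i; apply/eqP; rewrite -addrA -natrD addr_nat_eq.
Qed.

Lemma half_turn_neq (n : nat) (i : 'Z_n) :
  (1 < n)%N -> ~~ odd n -> i + 15%:R != i.
Proof.
move=> n_gt1 n_even; rewrite addr_nat_eq //; apply: contra n_even => n15.
exact: dvdn_odd n15 _.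
Qed.

(** If two elements of a group add up to a double, then both or neither are
    doubles; so the half-turn acts on the vertices whose label is a double. *)
Lemma even_card_doubles (n : nat) (G : finZmodType) (l : GP_vertex n -> G)
    (f : nat -> G) :
    (1 < n)%N -> (n %| 30)%N -> ~~ odd n -> bijective l ->
    (forall k, l (inl k%:R) + l (inl (15 + k)%:R) = f k *+ 2) ->
    (forall k, l (inr k%:R) + l (inr (15 + k)%:R) = f k *+ 2) ->
  ~~ odd #|doubles G|.
Proof.
move=> n_gt1 n30 n_even l_bij fa fb.
rewrite -(on_card_preimset (onW_bij _ l_bij)).
pose turn (v : GP_vertex n) : GP_vertex n :=
  match v with inl i => inl (i + 15%:R) | inr i => inr (i + 15%:R) end.
apply: (@even_card_involution _ turn) => [|v].
  by case=> i /=; congr (_ _); apply: half_turnK.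
have turnE : l v + l (turn v) \in doubles G.
  by case: v => i; rewrite -[i]natr_Zp /= -natrD addnC ?fa ?fb; apply: imset_f.
rewrite !inE => /imsetP[x _ lv]; case/imsetP: turnE => y _.
rewrite lv => /(canRL (addKr _)) ->; apply/andP; split.
  by apply/imsetP; exists (y - x); rewrite // mulrnBl addrC.
have turn_neq (i : 'Z_n) := half_turn_neq i n_gt1 n_even.
by case: v {lv} => i; apply: contra (turn_neq i) => /eqP[] /eqP.
Qed.

(** A pair of outer labels and the corresponding pair of inner labels both
    add up to 2 f_i, which accounts for the factor 4. *)
Lemma sum_labels_quadruple (n : nat) (G : finZmodType) (l : GP_vertex n -> G)
    (f : nat -> G) :
    (1 < n)%N -> (n %| 30)%N -> ~~ odd n -> bijective l ->
    (forall k, l (inl k%:R) + l (inl (15 + k)%:R) = f k *+ 2) ->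
    (forall k, l (inr k%:R) + l (inr (15 + k)%:R) = f k *+ 2) ->
  exists s, \sum_(x : G) x = s *+ 4.
Proof.
move=> n_gt1 n30 n_even l_bij fa fb.
have sK := half_turnK n_gt1 n30.
have sT : {in 'Z_n, forall i, (i + 15%:R \in 'Z_n) && (i + 15%:R != i)}.
  by move=> i _; rewrite half_turn_neq.
exists (\sum_(i : 'Z_n | (enum_rank i < enum_rank (i + 15%:R)%R)%N) f i).
rewrite (reindex l) /=; last exact: onW_bij.
rewrite big_sumType /= !(big_involution _ _ sK sT) /=.
have pair (g : 'Z_n -> GP_vertex n) :
    (forall k, l (g k%:R) + l (g (15 + k)%:R) = f k *+ 2) ->
    forall i : 'Z_n, l (g i) + l (g (i + 15%:R)) = f i *+ 2.
  by move=> gP i; rewrite -gP natrD natr_Zp [15%:R + _]addrC.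
under eq_bigr => i _ do rewrite (pair _ fa).
under [X in _ + X]eq_bigr => i _ do rewrite (pair _ fb).
by rewrite !sumrMnl -mulrnDr.
Qed.

Theorem lemma21 (n : nat) (hn : (5 <= n)%N) (Gamma : finZmodType)
    (hGamma : #|Gamma| = (2 * n)%N) :
  ~ distance_magic (GP n 2) Gamma.
Proof.
case=> l [l_bij [mu magic]].
have n_gt1 : (1 < n)%N by lia.
have [f [f3 fa fb]] := magic_half_turn hn magic.
have l_inj := bij_inj l_bij.
have n30 := dvdn_30 n_gt1 l_inj f3 fa.
have not8 : ~~ (8 %| 2 * n)%N.
  apply/negP; rewrite -[8%N]/(2 * 4)%N dvdn_pmul2l // => n4.
  by have := dvdn_trans n4 n30.
have cardG := card_two_torsion_doubles Gamma.
have [n_odd|n_even] := boolP (odd n).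
  have K_gt2 := odd_two_torsion_gt2 hn n30 n_odd l_inj f3 fa.
  have := dvdn_mulr #|doubles Gamma| (four_dvd_card_two_torsion K_gt2).
  by rewrite cardG hGamma -[4%N]/(2 * 2)%N dvdn_pmul2l // dvdn2 n_odd.
have [/four_dvd_card_two_torsion K4|K_le2] := ltnP 2 #|two_torsion Gamma|.
  have := even_card_doubles n_gt1 n30 n_even l_bij fa fb.
  rewrite -dvdn2 => D2; case/negP: not8.
  by rewrite -hGamma -cardG; apply: (@dvdn_mul 4 2).
have [s sumG] := sum_labels_quadruple n_gt1 n30 n_even l_bij fa fb.
have [|t _ ot] := @Cauchy Gamma 2 [set: Gamma]%G isT.
  by rewrite cardsT hGamma dvdn_mulr.
have t2 : t *+ 2 = 0 by rewrite -FinRing.zmodXgE -ot expg_order.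
have t_neq0 : t != 0.
  by apply/negP=> /eqP t0; move: ot; rewrite t0 -FinRing.zmod1gE order1.
have eqK : two_torsion Gamma = [set 0; t].
  apply/esym/eqP; rewrite eqEcard cards2 eq_sym t_neq0 K_le2 andbT.
  by apply/subsetP=> x; rewrite !inE => /orP[]/eqP->; rewrite ?mul0rn ?t2.
move: sumG; rewrite (sum_unique_involution t_neq0 eqK) => ts.
case/negP: not8; rewrite -hGamma; apply: (@eight_dvd_card _ s).
  by rewrite (mulrnA s 4 2) -ts.
by rewrite -ts.
Qed.
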